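(* Let $S$ be a semigroup and $a\in S$. Let $\tau_a: W(a)\to E(S)$ be the map $x\mapsto ax$. Then: - $\tau_a$ restricts to a one-to-one map from $W(a)\cap\{a\}'$ onto $\Sigma_1(a)$; - $\tau_a$ restricts to a one-to-one map from $W(a)\cap\{a\}''$ onto $\Sigma_2(a)$. In both cases the inverse map $\tau_a^{-1}$ sends $e$ to $b=a^{\parallel e}$.
   Context: $S$ is a semigroup, $S^1$ is $S$ with an identity adjoined if necessary, $E(S)$ is the set of idempotents of $S$. For $A\subseteq S$, $A'=\{x\in S: xa=ax\ \forall a\in A\}$ and $A''=(A')'$. $W(a)=\{x\in S: xax=x\}$ is the set of weak (outer) inverses of $a$. Green's preorders: $x\leq_{\mathcal L}y\iff x\in S^1y$; $x\leq_{\mathcal R}y\iff x\in yS^1$; $x\leq_{\mathcal H}y$ iff both hold; $x\,\mathcal H\,y$ iff $x\leq_{\mathcal H}y$ and $y\leq_{\mathcal H}x$. Inverse along an element: $a$ is invertible along $d$ if there is $b\in S$ with $bad=d=dab$ and $b\leq_{\mathcal H}d$; such $b$ is unique and denoted $a^{\parallel d}$. For $e\in E(S)$, $a^{\parallel e}$ exists if and only if $eae\,\mathcal H\,e$. $\Sigma_0(a)=\{e\in E(S): eae\,\mathcal H\,e\}$, $\Sigma_1(a)=\{a\}'\cap\Sigma_0(a)$, $\Sigma_2(a)=\{a\}''\cap\Sigma_0(a)$. *)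

(* Defs.v *)
From HB Require Import structures.
From mathcomp Require Import all_boot.
From mathcomp Require Import boolp classical_sets functions.

Set Implicit Arguments.
Unset Strict Implicit.
Unset Printing Implicit Defensive.

Local Open Scope classical_set_scope.
Local Open Scope group_scope.

Section Semigroups.
Variable S : semigroupType.
Implicit Types (a b d e x y : S) (A : set S).

(* S^1 y = {y} `|` S y and y S^1 = {y} `|` y S, whether or not S already has
   an identity; hence the monoid S^1 itself need not be constructed. *)
Definition S1mul y : set S := [set y] `|` [set s * y | s in [set: S]].
Definition mulS1 y : set S := [set y] `|` [set y * s | s in [set: S]].

Definition leL x y : Prop := S1mul y x.
Definition leR x y : Prop := mulS1 y x.
Definition leH x y : Prop := leL x y /\ leR x y.
Definition greenH x y : Prop := leH x y /\ leH y x.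

Definition idempotents : set S := [set e | e * e = e].

Definition commutant A : set S := [set x | forall a, A a -> commute x a].

Definition weak_inverses a : set S := [set x | x * a * x = x].

Definition inverse_along a d b : Prop :=
  [/\ b * a * d = d, d = d * a * b & leH b d].

Definition invertible_along a d : Prop := exists b, inverse_along a d b.

Lemma inverse_along_unique a d b c :
  inverse_along a d b -> inverse_along a d c -> b = c.
Proof.
move=> [bad dab [Lb Rb]] [cad dac [Lc Rc]].
have -> : b = b * a * c.
  case: Lb => [->|[s _ <-]]; first by [].
  by rewrite -!mulgA (mulgA d) -dac.
case: Rc => [->|[s _ <-]]; first by [].
by rewrite mulgA bad.
Qed.

(* The inverse of a along d; meaningful only if [invertible_along a d] holds,
   and equal to the arbitrary value a otherwise. *)
Definition inv_along a d : S := xget a [set b | inverse_along a d b].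

Lemma inv_alongP a d :
  invertible_along a d -> inverse_along a d (inv_along a d).
Proof. by case=> b ab; exact: (xgetPex a (ex_intro _ b ab)). Qed.

Definition Sigma0 a : set S := idempotents `&` [set e | greenH (e * a * e) e].
Definition Sigma1 a : set S := commutant [set a] `&` Sigma0 a.
Definition Sigma2 a : set S := commutant (commutant [set a]) `&` Sigma0 a.

Definition tau a x : S := a * x.

End Semigroups.

Arguments idempotents S : clear implicits.

Definition inverse_maps (T U : Type) (A : set T) (B : set U)
    (f : T -> U) (g : U -> T) : Prop :=
  [/\ set_fun A B f, set_fun B A g,
      {in A, cancel f g} & {in B, cancel g f}].

(* Main.v *)
(* If x is an outer inverse of a commuting with a, then e = ax = xa is an
   idempotent with xe = ex = x, and x is the inverse of a along e.  Conversely,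
   if an idempotent e commutes with a and eae H e, then eae = ae is a unit of the
   local monoid eSe; its inverse b there is the inverse of a along e, and
   ab = ba = e.  Finally, if y commutes with both a and e, then
   by = bey = bye = byab = bayb = eyb = yeb = yb,
   which transfers membership in {a}'' from e to b. *)
Require Import Defs.
From mathcomp Require Import all_boot.
From mathcomp Require Import boolp classical_sets functions.

Set Implicit Arguments.
Unset Strict Implicit.
Unset Printing Implicit Defensive.

Local Open Scope classical_set_scope.
Local Open Scope group_scope.

Lemma cancel_set_bij (T U : Type) (A : set T) (B : set U)
    (f : T -> U) (g : U -> T) :
  inverse_maps A B f g -> set_bij A B f.
Proof.
move=> [fAB gBA fK gK]; split=> //.
- by move=> x y Ax Ay fxy; rewrite -(fK x Ax) fxy fK.
- by move=> y By; exists (g y); [exact: gBA | rewrite gK // inE].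
Qed.

Section OuterInverses.
Variable S : semigroupType.
Implicit Types a b e x y : S.

Lemma commutant1P a x : commutant [set a] x <-> commute x a.
Proof. by split=> [|xa _ ->] //; apply. Qed.

(** Since $a$ lies in $\{a\}'$, every element of $\{a\}''$ commutes with it. *)
Lemma bicommutant1_sub a :
  commutant (commutant [set a]) `<=` commutant [set a].
Proof. by move=> x xC; apply/commutant1P/xC/commutant1P. Qed.

Lemma tau_idempotent a x : weak_inverses a x -> idempotents S (tau a x).
Proof.
by rewrite /weak_inverses /idempotents /tau /= => xax; rewrite -mulgA (mulgA x) xax.
Qed.

(** An idempotent $e$ is a right identity on $S^1e$ and a left identity on $eS^1$. *)
Lemma leH_idempotent e b : idempotents S e -> leH b e -> b * e = b /\ e * b = b.
Proof.
rewrite /idempotents /= => ee [Lb Rb]; split.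
- by case: Lb => [->//|[s _ <-]]; rewrite -mulgA ee.
- by case: Rb => [->//|[s _ <-]]; rewrite mulgA ee.
Qed.

Lemma inv_along_eq a d b : inverse_along a d b -> inv_along a d = b.
Proof.
by move=> ab; apply: (inverse_along_unique _ ab); apply: inv_alongP; exists b.
Qed.

Lemma commuting_outer_inverse_along a x :
  weak_inverses a x -> commute x a -> inverse_along a (tau a x) x.
Proof.
rewrite /weak_inverses /tau /= => xax xa; split.
- by rewrite -xa mulgA xax.
- by rewrite -2!mulgA (mulgA x) xax.
(* Here $x = x(ax)$ gives the left bound, while $x = (xa)x = (ax)x$ gives the right bound by
   commutation. *)
- split; right; exists x => //; first by rewrite mulgA.
  by rewrite -xa.
Qed.

(** As $be = b = eb$, multiplying $eae$ by $b$ on either side gives back $e$. *)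
Lemma idempotent_along_Sigma0 a e b :
  idempotents S e -> inverse_along a e b -> Sigma0 a e.
Proof.
move=> ee [bae eab be]; have [beE ebE] := leH_idempotent ee be.
split=> //; split; split; right.
- by exists (e * a).
- by exists (a * e); rewrite ?mulgA.
- by exists b; rewrite ?mulgA ?beE.
- by exists b; rewrite // -mulgA ebE.
Qed.

Lemma tau_Sigma0 a x :
  weak_inverses a x -> commute x a -> Sigma0 a (tau a x).
Proof.
move=> Wx xa; apply: idempotent_along_Sigma0 (tau_idempotent Wx) _.
exact: commuting_outer_inverse_along.
Qed.

Lemma Sigma0_invertible_along a e : Sigma0 a e -> invertible_along a e.
Proof.
move=> [ee [_ [Le Re]]]; rewrite /idempotents /= in ee.
have [s se] : exists s, s * (e * a * e) = e.
  by case: Le => [<-|[s _ se]]; [exists e | exists s].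
have [t te] : exists t, e * a * e * t = e.
  by case: Re => [<-|[t _ te]]; [exists e | exists t].
(* The left inverse $s$ and the right inverse $t$ of $eae$ agree once compressed to $eSe$: $ese =
   es(eae)t = et$. *)
have esete : e * s * e = e * t.
  by rewrite -[X in e * s * X]te -mulgA (mulgA s) se mulgA ee.
exists (e * s * e); split.
- by rewrite -(mulgA e s) -!mulgA (mulgA e a) se ee.
- by rewrite esete mulgA te.
- split; right; first by exists (e * s).
  by exists (s * e) => //; rewrite mulgA.
Qed.

Lemma Sigma1_inverse_along a e b : Sigma1 a e -> inverse_along a e b ->
  [/\ weak_inverses a b, commute b a & tau a b = e].
Proof.
move=> [/commutant1P ea [ee _]] [bae eab be].
have [beE ebE] := leH_idempotent ee be.
(* Insert $e$ next to $b$ and move it past $a$: $ab = aeb = eab = e$, and symmetrically $ba = bea =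
   bae = e$. *)
have abE : a * b = e by rewrite -[in LHS]ebE mulgA -ea -eab.
have baE : b * a = e by rewrite -[in LHS]beE -mulgA ea mulgA bae.
by split; rewrite /weak_inverses /commute /= ?baE ?ebE ?abE.
Qed.

Lemma Sigma2_Sigma1 a : Sigma2 a `<=` Sigma1 a.
Proof. by move=> e [/bicommutant1_sub]. Qed.

Lemma Sigma2_inverse_along a e b : Sigma2 a e -> inverse_along a e b ->
  commutant (commutant [set a]) b.
Proof.
move=> S2e abe y ya; have S1e := Sigma2_Sigma1 S2e.
have [_ ba abE] := Sigma1_inverse_along S1e abe.
have [eC [ee _]] := S2e; have [_ _ be] := abe.
have [beE ebE] := leH_idempotent ee be.
have ey : commute e y := eC y ya.
move/commutant1P: ya => ya.
(* An $e$ taken from $b = be$ moves to the right of $y$; expanding it as $ab$ lets $y$ pass $a$. *)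
rewrite /commute; have -> : b * y = b * (y * e) by rewrite -ey mulgA beE.
rewrite -abE /tau (mulgA y) ya !mulgA ba -[a * b]/(tau a b) abE.
by rewrite ey -mulgA ebE.
Qed.

Lemma tau_commutant_inverse a :
  inverse_maps (weak_inverses a `&` commutant [set a]) (Sigma1 a)
    (tau a) (inv_along a).
Proof.
split.
- move=> x [Wx /commutant1P xa]; split; last exact: tau_Sigma0.
  by apply/commutant1P; rewrite /commute /tau -mulgA xa.
- move=> e S1e; have [_ S0e] := S1e.
  have /Sigma1_inverse_along[//|Wb ba _] :=
    inv_alongP (Sigma0_invertible_along S0e).
  by split=> //; apply/commutant1P.
- move=> x /[!inE] -[Wx /commutant1P xa].
  exact/inv_along_eq/commuting_outer_inverse_along.
- move=> e /[!inE] S1e; have [_ S0e] := S1e.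
  by have /Sigma1_inverse_along[] := inv_alongP (Sigma0_invertible_along S0e).
Qed.

(** Both cancellations restrict from the case of $\{a\}'$; what remains is that the two maps
    preserve membership in $\{a\}''$. *)
Lemma tau_bicommutant_inverse a :
  inverse_maps (weak_inverses a `&` commutant (commutant [set a])) (Sigma2 a)
    (tau a) (inv_along a).
Proof.
have [tauS1 invW tauK invK] := tau_commutant_inverse a.
split.
- move=> x [Wx xC]; have [_ S0] := tauS1 x (conj Wx (bicommutant1_sub xC)).
  (* Any $y$ in $\{a\}'$ commutes with both factors of $ax$. *)
  split=> // y ya; move: (xC y ya) => xy; move/commutant1P: ya => ya.
  by rewrite /commute /tau -mulgA xy mulgA -ya mulgA.
- move=> e S2e; have [Wb _] := invW e (Sigma2_Sigma1 S2e).
  split=> //; apply: (Sigma2_inverse_along S2e).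
  by apply/inv_alongP/Sigma0_invertible_along; case: S2e.
- by move=> x /[!inE] -[Wx /bicommutant1_sub xC]; apply: tauK; rewrite inE.
- by move=> e /[!inE] S2e; apply: invK; rewrite inE; exact: Sigma2_Sigma1.
Qed.

End OuterInverses.

Theorem theorem2p7 (S : semigroupType) (a : S) :
  [/\ set_fun (weak_inverses a) (idempotents S) (tau a),
      [/\ set_bij (weak_inverses a `&` commutant [set a]) (Sigma1 a) (tau a),
          (forall e : S, Sigma1 a e -> invertible_along a e) &
          inverse_maps (weak_inverses a `&` commutant [set a]) (Sigma1 a)
            (tau a) (inv_along a)] &
      [/\ set_bij (weak_inverses a `&` commutant (commutant [set a]))
            (Sigma2 a) (tau a),
          (forall e : S, Sigma2 a e -> invertible_along a e) &
          inverse_maps (weak_inverses a `&` commutant (commutant [set a]))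
            (Sigma2 a) (tau a) (inv_along a)]].
Proof.
split; first by move=> x; exact: tau_idempotent.
- split; [exact/cancel_set_bij/tau_commutant_inverse | |
          exact: tau_commutant_inverse].
  by move=> e [_]; exact: Sigma0_invertible_along.
- split; [exact/cancel_set_bij/tau_bicommutant_inverse | |
          exact: tau_bicommutant_inverse].
  by move=> e [_]; exact: Sigma0_invertible_along.
Qed.
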